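(* Let $n$ be a positive integer. For each $r\ge 1$, $$\dim V_P=\begin{cases}(r+1)m^2 & \text{if } n=2m,\\ (r+1)m(m+1) & \text{if } n=2m+1,\end{cases}$$ where $V_P=G\cdot\mathfrak{u}_P^r$.
   Context: $k$ is an algebraically closed field, $G=GL_n(k)$, and $G$ acts on $\mathfrak{gl}_n$ (the $n\times n$ matrices over $k$) by conjugation and on $(\mathfrak{gl}_n)^r$ by simultaneous conjugation. $P$ is the parabolic subgroup of $G$ corresponding to the partition $[m,m]$ if $n=2m$, or $[m+1,m]$ if $n=2m+1$, and $\mathfrak{u}_P$ is the Lie algebra of its unipotent radical. Explicitly, $\mathfrak{u}_P$ is the space of all block matrices $\begin{pmatrix} 0 & 0 \\ A & 0 \end{pmatrix}$ where $A$ is an arbitrary $m\times m$ matrix if $n=2m$, or an arbitrary $m\times(m+1)$ matrix if $n=2m+1$ (diagonal zero blocks of sizes $m,m$, respectively $m+1,m$). $V_P=G\cdot\mathfrak{u}_P^r=\{(gu_1g^{-1},\ldots,gu_rg^{-1}) : g\in G,\ u_i\in\mathfrak{u}_P\}$, a Zariski-closed subvariety of $(\mathfrak{gl}_n)^r$. *)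

(* Defs.v *)
From HB Require Import structures.
From mathcomp Require Import all_boot all_order all_algebra.
From mathcomp Require Import classical_sets.
From mathcomp Require Import mpoly.

Set Implicit Arguments.
Unset Strict Implicit.
Unset Printing Implicit Defensive.

Import GRing.Theory.
Local Open Scope ring_scope.
Local Open Scope classical_set_scope.

Section Zariski.
Variables (k : fieldType) (W : vectType k).

(* Polynomial functions on [W] are polynomials in the coordinates with respect
   to a fixed basis; a linear change of basis does not affect which subsets
   are zero loci. *)
Definition polyfun (p : {mpoly k[\dim {:W}]}) (w : W) : k :=
  p.@[fun i => coord (vbasis {:W}) i w].

Definition zariski_closed (Z : set W) : Prop :=
  exists S : set {mpoly k[\dim {:W}]},
    Z = [set w | forall p, S p -> polyfun p w = 0].

Definition zariski_closed_in (V Z : set W) : Prop :=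
  exists2 C, zariski_closed C & Z = V `&` C.

Definition zariski_irreducible (Z : set W) : Prop :=
  Z !=set0 /\
  forall C1 C2, zariski_closed C1 -> zariski_closed C2 ->
    Z `<=` C1 `|` C2 -> Z `<=` C1 \/ Z `<=` C2.

Definition irreducible_chain (V : set W) (d : nat) (Z : nat -> set W) : Prop :=
  (forall i, (i <= d)%N ->
     zariski_closed_in V (Z i) /\ zariski_irreducible (Z i)) /\
  (forall i, (i < d)%N -> Z i `<` Z i.+1).

(* The topological (Krull) dimension of [V] with the topology induced by the
   Zariski topology of [W]: a chain Z 0 < ... < Z d has length d. *)
Definition zariski_dim (V : set W) (d : nat) : Prop :=
  (exists Z, irreducible_chain V d Z) /\
  (forall e Z, irreducible_chain V e Z -> (e <= d)%N).

End Zariski.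

Section ParabolicSaturation.
Variable k : fieldType.

Lemma half_split n : (uphalf n + n./2)%N = n.
Proof. by rewrite uphalf_half -addnA addnn odd_double_half. Qed.

(* [uphalf n] and [n./2] are m, m when n = 2m, and m + 1, m when n = 2m + 1;
   the cast identifies matrices of size [uphalf n + n./2] and [n]. *)
Definition uP n : set 'M[k]_n :=
  [set u | exists A : 'M[k]_(n./2, uphalf n),
     u = castmx (half_split n, half_split n) (block_mx 0 0 A 0)].

Definition VP n r : set {ffun 'I_r -> 'M[k]_n} :=
  [set x | exists g : 'M[k]_n, g \in unitmx /\
     exists u : 'I_r -> 'M[k]_n, (forall i, uP (u i)) /\
       x = [ffun i => g *m u i *m invmx g]].

End ParabolicSaturation.

(* Main.v *)
(** Upper bound, by counting: if a nonempty irreducible set carries a chain of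
length e below it, then multiplying by equations that cut out the smaller sets
produces at least N^e linearly independent functions of degree at most cN on it.
On the other hand V_P is covered by finitely many polynomial images of affine
d-space, d = dim G/P + r dim u_P, one for each Weyl translate of the big cell of
G/P, so functions of degree at most cN on it span a space of dimension O(N^d).

Lower bound: on the big cell, (X, A_1, ..., A_r) is sent to the conjugates of
the lower block matrices A_j by the unipotent matrix with upper block X.  Free
the parameters one at a time, starting from X = 0 and A_j = (1 0), first the
entries of X and then those of the A_j.  The images are irreducible, because any
two points are joined by a polynomial curve, and at each stage the new parameter
is a matrix entry of the image, which separates consecutive closures. *)

Require Import Defs.
From HB Require Import structures.
From mathcomp Require Import all_boot all_order all_fingroup all_algebra.
From mathcomp Require Import zify.
From mathcomp Require Import boolp classical_sets mpoly.

Set Implicit Arguments.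
Unset Strict Implicit.
Unset Printing Implicit Defensive.

Import GRing.Theory.
Local Open Scope ring_scope.
Local Open Scope classical_set_scope.

(** * Degree bounds for products, sums and substitutions; [msize p <= N.+1] means degree at most
    N *)

Section Degree.
Variable k : fieldType.

Lemma msize_le_1 n N : (msize (1 : {mpoly k[n]}) <= N.+1)%N.
Proof. by rewrite msize1. Qed.

Lemma msize_le_mul n N M (p q : {mpoly k[n]}) :
  (msize p <= N.+1)%N -> (msize q <= M.+1)%N -> (msize (p * q) <= (N + M).+1)%N.
Proof.
have [->|p0] := eqVneq p 0; first by rewrite mul0r msize0.
have [->|q0] := eqVneq q 0; first by rewrite mulr0 msize0.
move=> pN qN; rewrite msizeM // -subn1 leq_subLR.
by apply: leq_trans (leq_add pN qN) _; rewrite addSn addnS.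
Qed.

Lemma msize_le_sum n N I (s : seq I) (P : pred I) (F : I -> {mpoly k[n]}) :
  (forall i, P i -> (msize (F i) <= N.+1)%N) ->
  (msize (\sum_(i <- s | P i) F i) <= N.+1)%N.
Proof.
move=> FN; elim/big_ind: _ => [|p q pN qN|]; rewrite ?msize0 //.
by apply: leq_trans (msizeD_le _ _) _; rewrite geq_max pN.
Qed.

Lemma msize_le_exp n B (q : {mpoly k[n]}) e :
  (msize q <= B.+1)%N -> (msize (q ^+ e) <= (B * e).+1)%N.
Proof.
move=> qB; elim: e => [|e IHe]; first by rewrite expr0 msize_le_1.
by rewrite exprS mulnS; apply: msize_le_mul.
Qed.

Lemma msize_le_mmap n n' B N (h : 'I_n' -> {mpoly k[n]}) (p : {mpoly k[n']}) :
  (forall i, msize (h i) <= B.+1)%N -> (msize p <= N.+1)%N ->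
  (msize (mmap (mpolyC n (R := k)) h p) <= (B * N).+1)%N.
Proof.
move=> hB pN; rewrite /mmap big_seq; apply: msize_le_sum => m mp.
rewrite mul_mpolyC; apply: leq_trans (msizeZ_le _ _) _.
have mN : (mdeg m <= N)%N by rewrite -ltnS (leq_trans (msize_mdeg_lt mp)).
apply: (@leq_trans (B * mdeg m).+1); last by rewrite ltnS leq_mul2l mN orbT.
rewrite /mmap1 mdegE big_distrr /=.
elim/big_rec2: _ => [|i q e _ IH]; first exact: msize_le_1.
by apply: msize_le_mul => //; apply: msize_le_exp.
Qed.

End Degree.

(** * Independent polynomial functions and the length of irreducible chains *)

Section Coordinates.
Variables (k : fieldType) (W : vectType k).
Local Notation D := (\dim {:W}).
Implicit Types (Z V : set W).

Lemma polyfunM p q (w : W) : polyfun (p * q) w = polyfun p w * polyfun q w.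
Proof. exact: mevalM. Qed.

Lemma polyfun_sum I (s : seq I) (c : I -> k) (p : I -> {mpoly k[D]}) (w : W) :
  polyfun (\sum_(i <- s) c i *: p i) w = \sum_(i <- s) c i * polyfun (p i) w.
Proof.
by rewrite /polyfun raddf_sum; apply: eq_bigr => i _; rewrite /= mevalZ.
Qed.

Lemma zariski_closed_zeros (p : {mpoly k[D]}) :
  zariski_closed [set w : W | polyfun p w = 0].
Proof.
exists [set p]; apply/seteqP; split=> w /= => [pw q ->//|]; exact.
Qed.

Definition affine_poly (f : W -> k) (c : k) : {mpoly k[D]} :=
  \sum_(i < D) f (vbasis {:W})`_i *: 'X_i + c%:MP.

Lemma polyfun_affine (f : {scalar W}) c w :
  polyfun (affine_poly f c) w = f w + c.
Proof.
rewrite /polyfun mevalD mevalC; congr (_ + _).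
rewrite [in RHS](coord_vbasis (memvf w)) raddf_sum linear_sum.
by apply: eq_bigr => i _ /=; rewrite mevalZ mevalXU linearZ /= mulrC.
Qed.

Lemma irreducible_mul Z p q : zariski_irreducible Z ->
  (forall w, Z w -> polyfun p w * polyfun q w = 0) ->
  (forall w, Z w -> polyfun p w = 0) \/ (forall w, Z w -> polyfun q w = 0).
Proof.
move=> [_ Zirr] pq; apply: Zirr (zariski_closed_zeros p) (zariski_closed_zeros q) _.
by move=> w /pq/eqP; rewrite mulf_eq0 => /orP[]/eqP; [left|right].
Qed.

(** Says that the functions of degree at most N on Z span a space of dimension at least s, without
    forming that space. *)
Definition indep_on Z N s := exists p : 'I_s -> {mpoly k[D]},
  (forall i, (msize (p i) <= N.+1)%N) /\
  forall c : 'I_s -> k,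
    (forall w, Z w -> \sum_(i < s) c i * polyfun (p i) w = 0) -> forall i, c i = 0.

Lemma indep_on0 Z N : indep_on Z N 0.
Proof. by exists (fun=> 0); split=> [|c _] []. Qed.

Lemma indep_on_sub Z Z' N s : Z `<=` Z' -> indep_on Z N s -> indep_on Z' N s.
Proof.
by move=> ZZ' [p [pN pi]]; exists p; split=> // c c0; apply: pi => w /ZZ'; apply: c0.
Qed.

Lemma indep_on_le Z N N' s : (N <= N')%N -> indep_on Z N s -> indep_on Z N' s.
Proof.
by move=> NN' [p [pN pi]]; exists p; split=> // i; apply: leq_trans (pN i) _.
Qed.

Lemma indep_on_1 Z : Z !=set0 -> indep_on Z 0 1.
Proof.
move=> [w Zw]; exists (fun=> 1); split=> [i|c /(_ w Zw)]; first exact: msize_le_1.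
by rewrite big_ord1 /polyfun meval1 mulr1 => c0 i; rewrite ord1.
Qed.

(** The family consists of the p's and the multiples f q. On Z' a relation loses its f-part, so the
    coefficients of the p's vanish. What remains is f times a combination of the q's, zero on Z; as
    Z is irreducible and f is not zero on it, the combination vanishes on Z. *)
Lemma indep_on_add Z Z' f d N s s' : Z' `<=` Z -> zariski_irreducible Z ->
  (forall w, Z' w -> polyfun f w = 0) -> (exists2 w, Z w & polyfun f w != 0) ->
  (msize f <= d.+1)%N -> indep_on Z' (d + N) s -> indep_on Z N s' ->
  indep_on Z (d + N) (s + s').
Proof.
move=> ZZ' Zirr f0 [w0 Zw0 fw0] fd [p [pN pi]] [q [qN qi]].
exists (fun i => match split i with inl j => p j | inr j => f * q j end).
split=> [i|c c0]; first by case: split => j //; apply: msize_le_mul.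
have {}c0 w : Z w -> \sum_(i < s) c (lshift s' i) * polyfun (p i) w
    + polyfun f w * \sum_(i < s') c (rshift s i) * polyfun (q i) w = 0.
  move/c0 => c0w; rewrite -[RHS]c0w big_split_ord /=; congr (_ + _).
    by apply: eq_bigr => i _; rewrite (unsplitK (inl i)).
  rewrite mulr_sumr; apply: eq_bigr => i _.
  by rewrite (unsplitK (inr i)) polyfunM mulrCA.
have cl i : c (lshift s' i) = 0.
  move: i; apply: pi => w Z'w; have := c0 w (ZZ' w Z'w).
  by rewrite f0 // mul0r addr0.
have cr i : c (rshift s i) = 0.
  move: i; apply: qi => w Zw; rewrite -polyfun_sum.
  have fq v : Z v -> polyfun f v * polyfun (\sum_(i < s') c (rshift s i) *: q i) v = 0.
    move=> Zv; rewrite polyfun_sum -[RHS](c0 v Zv) [X in X + _]big1 ?add0r // => i _.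
    by rewrite cl mul0r.
  case: (irreducible_mul Zirr fq) => [fZ|/(_ w Zw)]; last by rewrite polyfun_sum.
  by rewrite fZ ?eqxx in fw0.
by move=> i; rewrite -(splitK i); case: (split i).
Qed.

(** Induction along the chain: one more step multiplies the number of independent functions by N,
    and the degree stays linear in N. *)
Lemma indep_on_chain V e (Z : nat -> set W) : irreducible_chain V e Z ->
  exists d, forall N, indep_on (Z e) (d * N) (N ^ e).
Proof.
move=> [Zcl Zlt].
suff H i : (i <= e)%N -> exists d, forall N, indep_on (Z i) (d * N) (N ^ i).
  exact: H.
elim: i => [_|i IHi ie].
  have [_ [Z0 _]] := Zcl 0%N isT; exists 0%N => N; exact: indep_on_1.
have [d' Hd'] := IHi (ltnW ie).
have [sZ nZ] := Zlt i ie.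
have [[_ [S ->] ZiE] _] := Zcl i (ltnW ie).
have [[C _ ZiE'] Zirr] := Zcl i.+1 ie.
have [w Zw nZw] : exists2 w, Z i.+1 w & ~ Z i w.
  by apply: contrapT => h; apply: nZ => w Zw; apply: contrapT => nZw; apply: h; exists w.
have [f Sf fw] : exists2 f, S f & polyfun f w != 0.
  apply: contrapT => h; apply: nZw; rewrite ZiE; split.
    by move: Zw; rewrite ZiE' => -[].
  move=> f Sf; apply/eqP/negPn/negP => fw; apply: h; exists f => //.
have f0 v : Z i v -> polyfun f v = 0 by rewrite ZiE => -[_]; apply.
pose d := msize f.
(* Each further factor f, which vanishes on [Z i] but not on [Z i.+1], contributes N^i new
   functions; j = N gives N^(i+1). *)
have step N j : indep_on (Z i.+1) (d * j + d' * N) (j * N ^ i).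
  elim: j => [|j IHj]; first by rewrite mul0n; apply: indep_on0.
  rewrite mulnS -addnA mulSn.
  apply: (indep_on_add (Z' := Z i) (f := f)) => //; first by exists w.
  by apply: indep_on_le (Hd' N); lia.
by exists (d + d')%N => N; rewrite mulnDl expnS.
Qed.

Lemma card_bmultinom d b : (#|{: 'X_{1..d < b}}| <= b ^ d)%N.
Proof.
have [->|b0] := posnP b.
  apply/leq_trans/leq0n; rewrite leqn0; apply/eqP/eq_card0 => -[m mb].
  by exfalso.
pose g (m : 'X_{1..d < b}) : {ffun 'I_d -> 'I_b} :=
  [ffun i => insubd (Ordinal b0) (m i)].
suff /leq_card : injective g by rewrite card_ffun !card_ord.
move=> m1 m2 /ffunP eg; apply/val_inj/mnmP => i.
have := congr1 val (eg i); rewrite !ffunE !val_insubd.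
have lt (m : 'X_{1..d < b}) : (m i < b)%N.
  by apply: leq_ltn_trans (bmdeg m); rewrite mdegE (bigD1 i) //= leq_addr.
by rewrite !lt.
Qed.

(** Evaluating after a substitution. R will be a polynomial ring, in several variables for charts
    and in one variable for curves. *)
Lemma rmorph_mmap (R : comNzRingType) (c : {rmorphism k -> R})
    (ev : {rmorphism R -> k}) n (h : 'I_n -> R) (p : {mpoly k[n]}) :
  cancel c ev -> ev (mmap c h p) = p.@[fun i => ev (h i)].
Proof.
move=> cK; rewrite /mmap mevalE rmorph_sum; apply: eq_bigr => m _.
rewrite rmorphM /= cK rmorph_prod; congr (_ * _).
by apply: eq_bigr => i _; rewrite rmorphXn.
Qed.

(** Pull the functions back to the #|T| copies of affine d-space. A relation among all pullbacks is
    a relation on V, so independence on V bounds s by the number of available coefficients. *)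
Lemma indep_on_parametrized V (T : finType) d (q : T -> 'I_D -> {mpoly k[d]}) :
  (forall w, V w -> exists τ t, forall i, coord (vbasis {:W}) i w = (q τ i).@[t]) ->
  exists B, forall N s, indep_on V N s -> (s <= #|T| * (B * N).+1 ^ d)%N.
Proof.
move=> Vq; pose B := (\max_τ \max_i msize (q τ i))%N; exists B => N s [p [pN pi]].
have qB τ i : (msize (q τ i) <= B.+1)%N.
  apply: leqW; apply: (@leq_trans (\max_i msize (q τ i))%N).
    exact: (leq_bigmax (F := fun i => msize (q τ i)) i).
  exact: (leq_bigmax (F := fun τ => \max_i msize (q τ i))%N τ).
pose Q τ j := mmap (mpolyC d (R := k)) (q τ) (p j).
have QN τ j : (msize (Q τ j) <= (B * N).+1)%N by apply: msize_le_mmap.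
pose J := (T * 'X_{1..d < (B * N).+1})%type.
(* Row j lists the coefficients of the pullbacks of [p j] to all charts; its columns suffice because
   every [Q τ j] has degree at most BN. *)
pose M := \matrix_(j < s, c < #|{: J}|) (Q (enum_val c).1 j)@_(enum_val c).2.
suff /eqP <- : row_free M.
  apply: leq_trans (rank_leq_col M) _.
  by rewrite card_prod leq_mul2l card_bmultinom orbT.
rewrite -kermx_eq0; apply/eqP/row_matrixP => l; rewrite row0.
have : row l (kermx M) *m M = 0 by rewrite -row_mul mulmx_ker row0.
move: (row l _) => u uM.
apply/rowP => j0; rewrite [RHS]mxE; move: j0; apply: (pi (u 0)) => w /Vq[τ [t wt]].
transitivity (\sum_(j < s) u 0 j *: Q τ j).@[t].
  rewrite raddf_sum; apply: eq_bigr => j _ /=; rewrite mevalZ; congr (_ * _).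
  rewrite /polyfun (rmorph_mmap (ev := meval t)); last exact: mevalC.
  exact: meval_eq.
rewrite (_ : \sum_(j < s) _ = 0) ?meval0 //; apply/mpolyP => m.
rewrite mcoeff0 raddf_sum /=.
have [mN|mN] := ltnP (mdeg m) (B * N).+1.
  have /rowP/(_ (enum_rank ((τ, BMultinom mN) : J))) := uM.
  rewrite !mxE => uM0; rewrite -[RHS]uM0; apply: eq_bigr => j _.
  by rewrite mcoeffZ mxE enum_rankK.
apply: big1 => j _; rewrite mcoeffZ memN_msupp_eq0 ?mulr0 //.
by apply: msize_mdeg_ge; apply: leq_trans mN.
Qed.

(** If d < e, any N > C(B+1)^d contradicts the bound: C(BN+1)^d <= C(B+1)^d N^d < N^(d+1) <= N^e. *)
Lemma leq_exponent e d C B : (forall N, N ^ e <= C * (B * N).+1 ^ d)%N -> (e <= d)%N.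
Proof.
move=> H; rewrite leqNgt; apply/negP => de.
have /(_ (C * B.+1 ^ d).+1) := H; set N := (C * _).+1.
apply/negP; rewrite -ltnNge.
apply: (@leq_ltn_trans (C * (B.+1 * N) ^ d)).
  rewrite leq_mul2l; apply/orP; right.
  by have [->//|d0] := posnP d; rewrite leq_exp2r //; lia.
rewrite expnMn mulnA; apply: (@leq_trans (N * N ^ d)).
  by rewrite ltn_pmul2r ?expn_gt0.
by rewrite -expnS leq_pexp2l.
Qed.

Lemma chain_length_parametrized V (T : finType) d (q : T -> 'I_D -> {mpoly k[d]}) :
  (forall w, V w -> exists τ t, forall i, coord (vbasis {:W}) i w = (q τ i).@[t]) ->
  forall e (Z : nat -> set W), irreducible_chain V e Z -> (e <= d)%N.
Proof.
move=> /indep_on_parametrized[B HB] e Z ch.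
have [c Hc] := indep_on_chain ch.
apply: (leq_exponent (C := #|T|) (B := B * c)) => N.
rewrite -mulnA; apply: HB; apply: indep_on_sub (Hc N).
by have [/(_ e (leqnn e))[[C _ ->] _] _] := ch => w [].
Qed.

(** * Zariski closures and chains made from them *)

Definition zclosure (Y : set W) : set W :=
  [set w | forall p, (forall y, Y y -> polyfun p y = 0) -> polyfun p w = 0].

Lemma zclosure_closed Y : zariski_closed (zclosure Y).
Proof. by exists [set p | forall y, Y y -> polyfun p y = 0]. Qed.

Lemma zclosure_sub Y C : zariski_closed C -> Y `<=` C -> zclosure Y `<=` C.
Proof. by move=> [S ->] YC w Yw p Sp; apply: Yw => y /YC; apply. Qed.

Lemma zclosure_irreducible V Y : Y `<=` V -> zariski_irreducible Y ->
  zariski_irreducible (V `&` zclosure Y).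
Proof.
move=> YV [[y Yy] Yirr].
have YZ : Y `<=` V `&` zclosure Y by move=> w Yw; split; [apply: YV|move=> p; apply].
split; first by exists y; apply: YZ.
move=> C1 C2 C1cl C2cl ZC.
have [YC|YC] := Yirr C1 C2 C1cl C2cl (subset_trans YZ ZC); [left|right].
  by move=> w [_]; apply: zclosure_sub.
by move=> w [_]; apply: zclosure_sub.
Qed.

(** The equation p of [Y i] also holds on its closure, so a point of [Y i.+1] violating p makes the
    inclusion of closures strict. *)
Lemma zclosure_chain V d (Y : nat -> set W) :
  (forall i, (i <= d)%N -> Y i `<=` V /\ zariski_irreducible (Y i)) ->
  (forall i, (i < d)%N -> Y i `<=` Y i.+1 /\ exists p,
     (forall y, Y i y -> polyfun p y = 0) /\ exists2 y, Y i.+1 y & polyfun p y != 0) ->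
  irreducible_chain V d (fun i => V `&` zclosure (Y i)).
Proof.
move=> YV Ylt; split=> i id_.
  have [YVi Yirr] := YV i id_; split; last exact: zclosure_irreducible.
  by exists (zclosure (Y i)) => //; apply: zclosure_closed.
have [YY [p [p0 [y Yy py]]]] := Ylt i id_; split.
  by move=> w [Vw Yw]; split=> // f f0; apply: Yw => v /YY; apply: f0.
move=> /(_ y)[].
  by split; [have [+ _] := YV i.+1 id_; apply|move=> f; apply].
by move=> _ /(_ p p0) /eqP; rewrite (negbTE py).
Qed.

End Coordinates.

(** * Irreducibility by means of polynomial curves *)

Section AlgebraicallyClosed.
Variables (k : closedFieldType) (W : vectType k).
Local Notation D := (\dim {:W}).

(** A root t of q - 1 gives q(t) = 1; if q - 1 is a nonzero constant, q is constant too. *)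
Lemma poly_nonroot (q : {poly k}) : q != 0 -> exists t, q.[t] != 0.
Proof.
move=> q0; have [/size_poly1P[c _ qc]|] := boolP (size (q - 1) == 1%N).
  exists 0; rewrite (_ : q = (c + 1)%:P) ?hornerC.
    by move: q0; rewrite -[q](subrK 1) qc -polyCD polyC_eq0.
  by rewrite -[LHS](subrK 1) qc -polyCD.
move=> /closed_rootP[t /eqP]; rewrite hornerD hornerN hornerC => /eqP.
by rewrite subr_eq0 => /eqP qt; exists t; rewrite qt oner_eq0.
Qed.

(** If neither closed set contains Y, take a point of Y outside each, with an equation it violates.
    Along a curve in Y joining these points both equations become nonzero polynomials in t; where
    their product is nonzero, the curve leaves both closed sets. *)
Lemma irreducible_curves (Y : set W) : Y !=set0 ->
  (forall y0 y1, Y y0 -> Y y1 -> exists2 γ : k -> W,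
     (forall t, Y (γ t)) /\ γ 0 = y0 /\ γ 1 = y1 &
     exists q : 'I_D -> {poly k}, forall t i,
       coord (vbasis {:W}) i (γ t) = (q i).[t]) ->
  zariski_irreducible Y.
Proof.
move=> Y0 Ycurve; split=> // C1 C2 [S1 ->] [S2 ->] YC.
apply: contrapT => /not_orP[].
move=> /existsNP[y1 /not_implyP[Yy1 /existsNP[p1 /not_implyP[Sp1 /eqP py1]]]].
move=> /existsNP[y2 /not_implyP[Yy2 /existsNP[p2 /not_implyP[Sp2 /eqP py2]]]].
have [γ [Yγ [γ0 γ1]] [q qγ]] := Ycurve y1 y2 Yy1 Yy2.
pose P p := mmap (@polyC k) q p.
have PE p t : (P p).[t] = polyfun p (γ t).
  rewrite -horner_evalE (rmorph_mmap (ev := horner_eval t)).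
    by apply: meval_eq => i; rewrite /= horner_evalE qγ.
  by move=> c; rewrite /= horner_evalE hornerC.
have nz p t : polyfun p (γ t) != 0 -> P p != 0.
  by apply: contra_neq => Pp; rewrite -PE Pp horner0.
have [t] : exists t, (P p1 * P p2).[t] != 0.
  apply: poly_nonroot; rewrite mulf_neq0 //.
    by apply: (nz p1 0); rewrite γ0.
  by apply: (nz p2 1); rewrite γ1.
rewrite hornerM !PE mulf_eq0 negb_or => /andP[n1 n2].
by have [/= /(_ p1 Sp1)/eqP|/= /(_ p2 Sp2)/eqP] := YC _ (Yγ t); apply/negP.
Qed.

End AlgebraicallyClosed.

(** * The big cell and its translates by permutations *)

Section UnipotentChart.
Variables (k : fieldType) (m1 m2 : nat).

Definition unip (R : nzRingType) (X : 'M[R]_(m1, m2)) : 'M[R]_(m1 + m2) :=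
  block_mx 1%:M X 0 1%:M.

Definition lower (R : nzRingType) (A : 'M[R]_(m2, m1)) : 'M[R]_(m1 + m2) :=
  block_mx 0 0 A 0.

(** The conjugate of [lower A] by [unip X], expanded so that its entries are visibly polynomial and
    R may be a polynomial ring. *)
Definition chart (R : nzRingType) (X : 'M[R]_(m1, m2)) (A : 'M[R]_(m2, m1)) :
    'M[R]_(m1 + m2) :=
  block_mx (X *m A) (- (X *m A *m X)) A (- (A *m X)).

Lemma unipK (X : 'M[k]_(m1, m2)) : unip X *m unip (- X) = 1%:M.
Proof.
rewrite /unip mulmx_block !mul1mx !mulmx1 !mul0mx !mulmx0 !addr0 add0r addNr.
by rewrite -scalar_mx_block.
Qed.

Lemma invmx_unip (X : 'M[k]_(m1, m2)) : invmx (unip X) = unip (- X).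
Proof.
by rewrite -[LHS]mulmx1 -(unipK X) mulKmx //; have [] := mulmx1_unit (unipK X).
Qed.

Lemma chartE (X : 'M[k]_(m1, m2)) A :
  chart X A = unip X *m lower A *m unip (- X).
Proof.
rewrite /unip /lower !mulmx_block !(mul1mx, mulmx1, mul0mx, mulmx0, addr0, add0r).
by rewrite !mulmxN.
Qed.

Lemma map_chart (R S : nzRingType) (f : {rmorphism R -> S}) X A :
  map_mx f (chart X A) = chart (map_mx f X) (map_mx f A).
Proof. by rewrite map_block_mx !map_mxN !map_mxM. Qed.

Lemma lup_decomposition n (A : 'M[k]_n) : exists s (L U : 'M[k]_n),
  [/\ perm_mx s *m A = L *m U, (forall i j : 'I_n, (i < j)%N -> L i j = 0) &
      (forall i j : 'I_n, (j < i)%N -> U i j = 0)].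
Proof.
case: n A => [A|n A]; first by exists 1%g, A, 1%:M; split=> [|[]|[]] //; rewrite !flatmx0.
have := cormen_lup_perm A; have := cormen_lup_correct A.
have := @cormen_lup_lower _ _ A; have := @cormen_lup_upper _ _ A.
case: (cormen_lup A) => [[P L] U] /= Uup Llow PA /is_perm_mxP[s Ps].
exists s, L, U; split=> [|i j ij|]; first by rewrite -Ps.
  by rewrite Llow ?(ltnW ij) // -val_eqE ltn_eqF.
by move=> i j; apply: Uup.
Qed.

(** An LUP decomposition of the transpose writes K, up to a column permutation, as lower times upper
    triangular. The upper left block is then the product of the upper left blocks of the factors,
    which are invertible because the factors are. *)
Lemma ulsubmx_perm_unit (K : 'M[k]_(m1 + m2)) : K \in unitmx ->
  exists s, ulsubmx (K *m perm_mx s) \in unitmx.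
Proof.
move=> Ku; have [s [L [U [PK Llow Uup]]]] := lup_decomposition K^T.
have {}PK : K *m perm_mx s^-1 = U^T *m L^T.
  by rewrite -trmx_mul -PK trmx_mul trmxK tr_perm_mx.
have : U^T *m L^T \in unitmx by rewrite -PK unitmx_mul Ku unitmx_perm.
move=> H; exists s^-1%g; rewrite PK.
have Uur : ursubmx U^T = 0.
  by apply/matrixP => i j; rewrite !mxE Uup //= (leq_trans (ltn_ord i)) ?leq_addr.
have Ldl : dlsubmx L^T = 0.
  by apply/matrixP => i j; rewrite !mxE Llow //= (leq_trans (ltn_ord j)) ?leq_addr.
move: H; rewrite unitmx_mul -(submxK U^T) -(submxK L^T) Uur Ldl.
rewrite mulmx_block block_mxKul mul0mx addr0 unitmx_mul !unitmxE.
rewrite det_lblock det_ublock !unitrM.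
by case/andP => /andP[-> _] /andP[-> _].
Qed.

(* Off a permutation, [g] lies in the big cell: writing the block decomposition
   of [g^-1 w] as [[a, b], [c, d]] with [a] invertible, [X = - a^-1 b] makes
   [g^-1 w (unip X)] block lower triangular, i.e. an element of P. *)
Lemma big_cell_cover (g : 'M[k]_(m1 + m2)) : g \in unitmx ->
  exists s (X : 'M[k]_(m1, m2)), forall A, exists A',
    g *m lower A *m invmx g = perm_mx s *m chart X A' *m perm_mx s^-1.
Proof.
move=> gu; have [s] : exists s, ulsubmx (invmx g *m perm_mx s) \in unitmx.
  by apply: ulsubmx_perm_unit; rewrite unitmx_inv.
set K := invmx g *m perm_mx s => au.
pose X := - (invmx (ulsubmx K) *m ursubmx K).
exists s, X => A.
pose q := K *m unip X.
have qE : q = block_mx (ulsubmx K) 0 (dlsubmx K) (drsubmx q).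
  rewrite -[LHS]submxK; congr block_mx; rewrite /q -{1}(submxK K) mulmx_block.
  - by rewrite block_mxKul mulmx1 mulmx0 addr0.
  - by rewrite block_mxKur mulmx1 /X mulmxN mulKVmx // addNr.
  - by rewrite block_mxKdl mulmx1 mulmx0 addr0.
have Ku : K \in unitmx by rewrite unitmx_mul unitmx_inv gu unitmx_perm.
have Eu : unip X \in unitmx by have [] := mulmx1_unit (unipK X).
have qu : q \in unitmx by rewrite unitmx_mul Ku.
have du : drsubmx q \in unitmx.
  by move: qu; rewrite {1}qE !unitmxE det_lblock unitrM => /andP[].
(* Since q is block lower triangular, conjugation by it preserves the matrices [lower A]; comparing
   lower left blocks in q [lower A'] = [lower A] q forces this value. *)
pose A' := invmx (drsubmx q) *m (A *m ulsubmx K).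
have qA : q *m lower A' = lower A *m q.
  rewrite qE /lower !mulmx_block !(mul0mx, mulmx0, addr0, add0r).
  by rewrite /A' mulKVmx.
exists A'; rewrite chartE -invmx_unip.
have gq : g *m q = perm_mx s *m unip X by rewrite /q /K !mulmxA mulmxV // mul1mx.
have qK : invmx (unip X) *m perm_mx s^-1 *m g = invmx q.
  rewrite -[LHS](mulKmx qu) -[RHS]mulmx1; congr (_ *m _).
  rewrite /q /K -!mulmxA.
  rewrite (mulmxA (unip X)) mulmxV // mul1mx (mulmxA (perm_mx s)) -perm_mxM.
  by rewrite mulgV perm_mx1 mul1mx mulVmx.
clearbody q; rewrite -[RHS](mulmxK gu); congr (_ *m _).
rewrite !mulmxA -gq -!mulmxA (mulmxA (invmx (unip X))) qK.
by rewrite (mulmxA q) qA -mulmxA mulmxV // mulmx1.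
Qed.
End UnipotentChart.

(** * Linear forms on tuples of matrices *)

Section Entries.
Variables (k : fieldType) (r n : nat).
Local Notation W := {ffun 'I_r -> 'M[k]_n}.

Definition entry (j : 'I_r) (a b : 'I_n) (w : W) : k := w j a b.

Lemma entry_is_linear j a b : linear_for *%R (entry j a b).
Proof. by move=> c u v; rewrite /entry !ffunE !mxE. Qed.

HB.instance Definition _ j a b :=
  GRing.isLinear.Build k W k *%R (entry j a b) (entry_is_linear j a b).

Definition unit_tuple (j : 'I_r) (a b : 'I_n) : W :=
  [ffun j' => if j' == j then delta_mx a b else 0].

Lemma tuple_sum_entries (w : W) :
  w = \sum_j \sum_a \sum_b w j a b *: unit_tuple j a b.
Proof.
apply/ffunP => j0; rewrite sum_ffunE (bigD1 j0) //=.
rewrite [X in _ = _ + X]big1 ?addr0 => [|j jj0]; last first.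
  rewrite sum_ffunE big1 // => a _; rewrite sum_ffunE big1 // => b _.
  by rewrite !ffunE eq_sym (negbTE jj0) scaler0.
rewrite {1}(matrix_sum_delta (w j0)) sum_ffunE.
apply: eq_bigr => a _; rewrite sum_ffunE; apply: eq_bigr => b _.
by rewrite !ffunE eqxx.
Qed.

(** The linear form f after base change along c. Applied to matrices of polynomials, it yields the
    polynomials expressing the coordinates of a parametrized tuple. *)
Definition extend_scalar (R : comNzRingType) (c : k -> R) (f : W -> k)
    (M : 'I_r -> 'M[R]_n) : R :=
  \sum_j \sum_a \sum_b M j a b * c (f (unit_tuple j a b)).

Lemma extend_scalarE (R : comNzRingType) (c : k -> R) (ev : {rmorphism R -> k})
    (f : {scalar W}) M : cancel c ev ->
  ev (extend_scalar c f M) = f [ffun j => map_mx ev (M j)].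
Proof.
move=> cK; rewrite (tuple_sum_entries [ffun j => _]) /extend_scalar.
rewrite rmorph_sum linear_sum; apply: eq_bigr => j _ /=.
rewrite rmorph_sum linear_sum; apply: eq_bigr => a _ /=.
rewrite rmorph_sum linear_sum; apply: eq_bigr => b _ /=.
by rewrite rmorphM /= cK linearZ /= ffunE mxE.
Qed.
End Entries.

(** * The dimension of the saturation for blocks of sizes m1, m2 *)

Section Dimension.
Variables (k : closedFieldType) (m1 m2 r : nat).
Local Notation n := (m1 + m2)%N.
Local Notation W := {ffun 'I_r -> 'M[k]_n}.
Local Notation D := (\dim {:W}).
Local Notation param := ('I_m1 * 'I_m2 + 'I_r * ('I_m2 * 'I_m1))%type.

Definition saturation : set W :=
  [set x | exists g : 'M[k]_n, g \in unitmx /\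
     exists u : 'I_r -> 'M[k]_n, (forall i, exists A, u i = lower A) /\
       x = [ffun i => g *m u i *m invmx g]].

Definition param_chart (R : nzRingType) (t : param -> R) (j : 'I_r) : 'M[R]_n :=
  chart (\matrix_(a, b) t (inl (a, b))) (\matrix_(a, b) t (inr (j, (a, b)))).

Lemma map_param_chart (R S : nzRingType) (f : {rmorphism R -> S}) t j :
  map_mx f (param_chart t j) = param_chart (f \o t) j.
Proof.
by rewrite map_chart; congr chart; apply/matrixP => a b; rewrite !mxE.
Qed.

Lemma card_param : #|{: param}| = ((r + 1) * (m1 * m2))%N.
Proof. rewrite card_sum !card_prod !card_ord; lia. Qed.

Lemma saturation_param_chart t : saturation [ffun j => param_chart t j].
Proof.
exists (unip (\matrix_(a, b) t (inl (a, b)))); split.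
  by have [] := mulmx1_unit (unipK (\matrix_(a, b) t (inl (a, b)))).
exists (fun j => lower (\matrix_(a, b) t (inr (j, (a, b))))); split.
  by move=> j; eexists.
by apply/ffunP => j; rewrite !ffunE /param_chart chartE invmx_unip.
Qed.

Lemma saturation_cover w : saturation w -> exists (s : 'S_n) t,
  w = [ffun j => perm_mx s *m param_chart t j *m perm_mx s^-1].
Proof.
move=> [g [gu [u [uA ->]]]]; have [s [X HX]] := big_cell_cover gu.
(* The permutation and X depend on g alone, so one chart serves all components; only A' varies with
   j. *)
have /(_ _)/cid-/all_sig[A' HA'] : forall j, exists A',
    g *m u j *m invmx g = perm_mx s *m chart X A' *m perm_mx s^-1.
  by move=> j; have [A ->] := uA j; apply: HX.
exists s, (fun i => match i with inl (a, b) => X a b | inr (j, (a, b)) => A' j a b end).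
apply/ffunP => j; rewrite !ffunE HA' /param_chart /=.
have matrix_eta p q (B : 'M[k]_(p, q)) : \matrix_(a, b) B a b = B.
  by apply/matrixP => a b; rewrite mxE.
by rewrite !matrix_eta.
Qed.

Lemma saturation_dim_le e (Z : nat -> set W) :
  irreducible_chain saturation e Z -> (e <= (r + 1) * (m1 * m2))%N.
Proof.
rewrite -card_param.
pose R := {mpoly k[#|{: param}|]}.
pose C s : 'M[R]_n := map_mx (@mpolyC _ k) (perm_mx s).
pose M (s : 'S_n) j : 'M[R]_n :=
  C s *m param_chart (fun i => 'X_(enum_rank i)) j *m C s^-1%g.
(* One chart for each permutation, with an indeterminate for each parameter. *)
apply: (chain_length_parametrized (T := 'S_n)
  (q := fun s i => extend_scalar (@mpolyC _ k) (coord (vbasis {:W}) i) (M s))).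
move=> w /saturation_cover[s [t ->]]; exists s, (t \o enum_val) => i.
rewrite (extend_scalarE (ev := meval _)); last exact: mevalC.
congr (coord _ _ _); apply/ffunP => j; rewrite !ffunE /M !map_mxM map_param_chart.
have CK s' : map_mx (meval (t \o enum_val)) (C s') = perm_mx s'.
  by apply/matrixP => a b; rewrite !mxE /= mevalC.
rewrite !CK (_ : _ \o _ = t) //; apply/funext => i0.
by rewrite /= mevalXU /= enum_rankK.
Qed.

(** X = 0 and every A_j = (1 0). With this A_j and m2 <= m1, the first m2 columns of X A_j are X
    itself. *)
Definition base_param (i : param) : k :=
  match i with inl _ => 0 | inr (_, (a, b)) => (a == b :> nat)%:R end.

(* The entries of [X] come before those of the [A_j]. *)
Definition param_rank (i : param) : nat :=
  match i with
  | inl x => enum_rank x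
  | inr y => #|{: 'I_m1 * 'I_m2}| + enum_rank y
  end.

Lemma param_rank_surj l : (l < #|{: param}|)%N -> exists i, param_rank i = l.
Proof.
rewrite card_sum => lt; have [ltl|gel] := ltnP l #|{: 'I_m1 * 'I_m2}|.
  by exists (inl (enum_val (Ordinal ltl))); rewrite /= enum_valK.
have lt' : (l - #|{: 'I_m1 * 'I_m2}| < #|{: 'I_r * ('I_m2 * 'I_m1)}|)%N.
  by rewrite ltn_subLR.
by exists (inr (enum_val (Ordinal lt'))); rewrite /= enum_valK subnKC.
Qed.

(** The tuples in the chart for which only the first l parameters are free. *)
Definition slice (l : nat) : set W :=
  [set w | exists2 t, (forall i, (l <= param_rank i)%N -> t i = base_param i) &
     w = [ffun j => param_chart t j]].

Lemma slice_irreducible l : zariski_irreducible (slice l).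
Proof.
apply: irreducible_curves.
  by exists [ffun j => param_chart base_param j]; exists base_param.
move=> _ _ [t0 ht0 ->] [t1 ht1 ->].
exists (fun s => [ffun j => param_chart (fun i => t0 i + s * (t1 i - t0 i)) j]).
  split; last split.
  - move=> s; exists (fun i => t0 i + s * (t1 i - t0 i)) => // i li.
    by rewrite ht0 // ht1 // subrr mulr0 addr0.
  - apply/ffunP => j; rewrite !ffunE; congr (param_chart _ j).
    by apply/funext => i; rewrite mul0r addr0.
  - apply/ffunP => j; rewrite !ffunE; congr (param_chart _ j).
    by apply/funext => i; rewrite mul1r addrC subrK.
exists (fun i => extend_scalar (@polyC k) (coord (vbasis {:W}) i)
  (param_chart (fun i => (t0 i)%:P + 'X * (t1 i - t0 i)%:P))) => s i.
rewrite -horner_evalE (extend_scalarE (ev := horner_eval s)); last first.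
  by move=> c; rewrite /= horner_evalE hornerC.
congr (coord _ _ _); apply/ffunP => j; rewrite !ffunE map_param_chart.
congr (param_chart _ j); apply/funext => i0.
by rewrite /= horner_evalE hornerD hornerM hornerX !hornerC.
Qed.

Lemma saturation_chain : (m2 <= m1)%N -> (0 < r)%N ->
  exists Z : nat -> set W, irreducible_chain saturation ((r + 1) * (m1 * m2)) Z.
Proof.
move=> m21 r0; rewrite -card_param.
exists (fun l => saturation `&` zclosure (slice l)).
apply: zclosure_chain => l ld.
  split; last exact: slice_irreducible.
  by move=> _ [t _ ->]; apply: saturation_param_chart.
split.
  by move=> _ [t ht ->]; exists t => // i li; apply: ht; apply: ltnW.
have [i il] := param_rank_surj ld.
(* A matrix entry that reads off the newly freed parameter i on the whole of [slice l.+1]. *)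
have [f Hf] : exists f : {scalar W}, forall t,
    (forall i, (l.+1 <= param_rank i)%N -> t i = base_param i) ->
    f [ffun j => param_chart t j] = t i.
  case: i il => [[a b]|[j [a b]]] /= il.
    (* While X is being freed, the first A is still (1 0), so X_ab stands in the upper left block X
       A. *)
    exists (entry (Ordinal r0) (lshift m2 a) (lshift m2 (widen_ord m21 b))) => t ht.
    have htr y : t (inr y) = base_param (inr y).
      by apply: ht; rewrite -il; apply: leq_trans (ltn_ord _) (leq_addr _ _).
    rewrite /= /entry ffunE block_mxEul mxE (bigD1 b) //= !mxE htr /= eqxx mulr1.
    rewrite big1 ?addr0 // => c cb.
    by rewrite !mxE htr /= val_eqE (negbTE cb) mulr0.
  (* The lower left block of the chart is A_j itself, whatever X is. *)
  exists (entry j (rshift m1 a) (lshift m2 b)) => t ht.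
  by rewrite /= /entry ffunE block_mxEdl mxE.
exists (affine_poly f (- base_param i)); split.
  move=> _ [t ht ->]; rewrite polyfun_affine Hf ?ht ?il ?subrr // => i' li'.
  by apply: ht; apply: ltnW.
(* Moving parameter i by 1 from its base value gives a point where the equation of [slice l] takes
   the value 1. *)
pose t i' := base_param i' + (i' == i)%:R.
have ht i' : (l.+1 <= param_rank i')%N -> t i' = base_param i'.
  rewrite /t; case: eqVneq => [->|_ _]; first by rewrite il ltnn.
  by rewrite addr0.
exists [ffun j => param_chart t j]; first by exists t.
by rewrite polyfun_affine Hf // /t eqxx addrAC subrr add0r oner_eq0.
Qed.

Lemma saturation_dim : (m2 <= m1)%N -> (0 < r)%N ->
  zariski_dim saturation ((r + 1) * (m1 * m2)).
Proof.
by move=> m21 r0; split; [apply: saturation_chain|apply: saturation_dim_le].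
Qed.

(** With N a variable, the equality e can be eliminated, and the cast disappears. *)
Lemma saturation_cast_dim N (e : (m1 + m2)%N = N) : (m2 <= m1)%N -> (0 < r)%N ->
  zariski_dim [set x : {ffun 'I_r -> 'M[k]_N} | exists g, g \in unitmx /\
     exists u : 'I_r -> 'M[k]_N,
       (forall i, exists A, u i = castmx (e, e) (lower A)) /\
       x = [ffun i => g *m u i *m invmx g]]
    ((r + 1) * (m1 * m2)).
Proof. by case: N / e; apply: saturation_dim. Qed.

End Dimension.

Lemma VP_dim (k : closedFieldType) (n r : nat) : (0 < r)%N ->
  zariski_dim (@VP k n r) ((r + 1) * (uphalf n * n./2)).
Proof. by apply: saturation_cast_dim; rewrite uphalf_half leq_addl. Qed.

Theorem proposition4p1p1 (k : closedFieldType) (n r : nat)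
    (hn : (0 < n)%N) (hr : (1 <= r)%N) :
  (forall m : nat, n = (2 * m)%N ->
     zariski_dim (@VP k n r) ((r + 1) * m ^ 2)%N) /\
  (forall m : nat, n = (2 * m + 1)%N ->
     zariski_dim (@VP k n r) ((r + 1) * m * (m + 1))%N).
Proof.
have dimV := VP_dim k n hr; split=> m nE.
  have [uE hE] : uphalf n = m /\ n./2 = m by lia.
  by rewrite uE hE mulnn in dimV.
have [uE hE] : uphalf n = m.+1 /\ n./2 = m by lia.
by rewrite uE hE in dimV; rewrite -mulnA (addn1 m) (mulnC m).
Qed.
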